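(* Let $k$ be an algebraically closed field of characteristic $0$, let $m<n$ be relatively prime positive integers, and let $a$ be a positive integer. Then the Fermat-type curve $C\subset\mathbb{P}(1,m,n)$ defined by $x_0^{amn}+x_1^{an}-x_2^{am}=0$ is smooth.
   Context: $\mathbb{P}(1,m,n)=\mathrm{Proj}\,k[x_0,x_1,x_2]$ is the weighted projective plane over $k$, where the polynomial ring is graded by $\deg x_0=1$, $\deg x_1=m$, $\deg x_2=n$. A Fermat-type curve is the closed subscheme $C\subset\mathbb{P}(1,m,n)$ defined by the (weighted) homogeneous polynomial $x_0^{amn}+x_1^{an}-x_2^{am}$, $a\ge 1$. *)

(* Defs.v *)
From HB Require Import structures.
From mathcomp Require Import all_boot all_algebra generic_quotient.
From mathcomp Require Import boolp mpoly.
From mathcomp Require Import ring.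

Set Implicit Arguments.
Unset Strict Implicit.
Unset Printing Implicit Defensive.

Import GRing.Theory.
Local Open Scope ring_scope.
Local Open Scope quotient_scope.

Section Ideals.

Definition gen_ideal (R : comPzRingType) (s : seq R) (x : R) : Prop :=
  exists c : nat -> R, x = \sum_(i < size s) c i * s`_i.

Variables (R : comPzRingType) (s : seq R).

Lemma gen_ideal0 : gen_ideal s 0.
Proof. by exists (fun=> 0); rewrite big1 // => i _; rewrite mul0r. Qed.

Lemma gen_idealD x y : gen_ideal s x -> gen_ideal s y -> gen_ideal s (x + y).
Proof.
move=> [c ->] [d ->]; exists (fun i => c i + d i).
by rewrite -big_split; apply: eq_bigr => i _; rewrite mulrDl.
Qed.

Lemma gen_idealM a x : gen_ideal s x -> gen_ideal s (a * x).
Proof.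
move=> [c ->]; exists (fun i => a * c i).
by rewrite mulr_sumr; apply: eq_bigr => i _; rewrite mulrA.
Qed.

End Ideals.

(* Commutative k-algebras, the zero algebra included; the bundled comAlgType
   of MathComp excludes it. *)
Record kalg (k : fieldType) := KAlg {
  kalg_ring :> comPzRingType;
  kalg_in : {rmorphism k -> kalg_ring}
}.

Section Smooth.

Variable k : fieldType.

Definition kalg_hom (A B : kalg k) (f : {rmorphism A -> B}) : Prop :=
  forall c : k, f (kalg_in A c) = kalg_in B c.

Definition kalg_mpoly (n : nat) : kalg k := @KAlg k {mpoly k[n]} (@mpolyC n k).

Definition finitely_presented (A : kalg k) : Prop :=
  exists (n : nat) (p : {rmorphism kalg_mpoly n -> A}),
    [/\ kalg_hom p,
        forall a : A, exists q, p q = a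
      & exists s : seq {mpoly k[n]}, forall q, p q = 0 <-> gen_ideal s q].

(* The surjections p are, up to isomorphism, the quotients B -> B/J, J^2 = 0. *)
Definition formally_smooth (A : kalg k) : Prop :=
  forall (B B' : kalg k) (p : {rmorphism B -> B'}),
    kalg_hom p ->
    (forall b', exists b, p b = b') ->
    (forall x y, p x = 0 -> p y = 0 -> x * y = 0) ->
    forall f : {rmorphism A -> B'}, kalg_hom f ->
    exists g : {rmorphism A -> B}, kalg_hom g /\ forall a, p (g a) = f a.

Definition smooth_alg (A : kalg k) : Prop :=
  finitely_presented A /\ formally_smooth A.

End Smooth.

Definition wdeg (n : nat) (w : 'I_n -> nat) (m : 'X_{1..n}) : nat :=
  (\sum_(i < n) w i * m i)%N.

Section WDeg.

Variables (n : nat) (w : 'I_n -> nat).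

Lemma wdeg0 : wdeg w 0%MM = 0%N.
Proof. by rewrite /wdeg big1 // => i _; rewrite mnm0E muln0. Qed.

Lemma wdegD : {morph wdeg w : m1 m2 / (m1 + m2)%MM >-> (m1 + m2)%N}.
Proof.
move=> m1 m2; rewrite /wdeg -big_split.
by apply: eq_bigr => i _; rewrite mnmDE mulnDr.
Qed.

HB.instance Definition _ := isMeasure.Build n (wdeg w) wdeg0 wdegD.

End WDeg.

(* Homogeneous elements f of positive degree of S = k[x_0, ..., x_(n-1)],
   deg x_i = w i; they index the basic affine open sets D_+(f). *)
Record hform (k : fieldType) (n : nat) (w : 'I_n -> nat) := HForm {
  hform_poly :> {mpoly k[n]};
  hform_deg : nat;
  hform_deg_gt0 : (0 < hform_deg)%N;
  hform_homog : hform_poly \is hform_deg.-homog for (wdeg w)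
}.

(* Points of the closed subscheme V_+(s) of Proj S. *)
Record proj_point (k : fieldType) (n : nat) (w : 'I_n -> nat)
    (s : seq {mpoly k[n]}) := ProjPoint {
  pt_ideal :> {mpoly k[n]} -> Prop;
  pt_ideal0 : pt_ideal 0;
  pt_idealD : forall g h, pt_ideal g -> pt_ideal h -> pt_ideal (g + h);
  pt_idealM : forall g h, pt_ideal h -> pt_ideal (g * h);
  pt_prime : forall g h, pt_ideal (g * h) -> pt_ideal g \/ pt_ideal h;
  pt_homog : forall g d, pt_ideal g -> pt_ideal (pihomog (wdeg w) d g);
  pt_relevant : exists f : hform k w, ~ pt_ideal f;
  pt_contains : forall g, g \in s -> pt_ideal g
}.

Lemma hfrac_add_id (R : comPzRingType) (a a' b b' u u' v v' M N : R) :
  N * v * v' * (M * (a' * u - a * u')) + M * u * u' * (N * (b' * v - b * v')) =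
  M * N * ((a' * v' + b' * u') * (u * v) - (a * v + b * u) * (u' * v')).
Proof. by ring. Qed.

Lemma hfrac_opp_id (R : comPzRingType) (a a' u u' N : R) :
  -1 * (N * (a' * u - a * u')) = N * (- a' * u - - a * u').
Proof. by ring. Qed.

Lemma hfrac_mul_id (R : comPzRingType) (a a' b b' u u' v v' M N : R) :
  N * b' * v * (M * (a' * u - a * u')) + M * a * u' * (N * (b' * v - b * v')) =
  M * N * (a' * b' * (u * v) - a * b * (u' * v')).
Proof. by ring. Qed.

(* The coordinate ring (S/(s))_(f) of V_+(s) /\ D_+(f): the degree-0 part of
   the localization of S/(s) at the powers of f. *)
Section Chart.

Variables (k : fieldType) (n : nat) (w : 'I_n -> nat).
Variables (s : seq {mpoly k[n]}) (f : hform k w).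
Local Notation p := (hform_poly f).

(* The pair (g, e) stands for the fraction g / f ^+ e. *)
Definition hfrac :=
  {x : {mpoly k[n]} * nat | x.1 \is (x.2 * hform_deg f)%N.-homog for (wdeg w)}.

Implicit Types x y z : hfrac.

Definition hfrac_rel x y : bool :=
  `[< exists N, gen_ideal s
        (p ^+ N * ((val x).1 * p ^+ (val y).2 - (val y).1 * p ^+ (val x).2)) >].

Lemma hfrac_relP x y : reflect
  (exists N, gen_ideal s
     (p ^+ N * ((val x).1 * p ^+ (val y).2 - (val y).1 * p ^+ (val x).2)))
  (hfrac_rel x y).
Proof. exact: asboolP. Qed.

Lemma hfrac_rel_refl : reflexive hfrac_rel.
Proof.
by move=> x; apply/hfrac_relP; exists 0%N; rewrite subrr mulr0; apply: gen_ideal0.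
Qed.

Lemma hfrac_rel_sym : ssrbool.symmetric hfrac_rel.
Proof.
suff H x y : hfrac_rel x y -> hfrac_rel y x by move=> x y; apply/idP/idP; apply: H.
move=> /hfrac_relP[N H]; apply/hfrac_relP; exists N.
by rewrite -opprB mulrN -mulN1r; apply: gen_idealM.
Qed.

Lemma hfrac_rel_trans : transitive hfrac_rel.
Proof.
move=> y x z /hfrac_relP[M HM] /hfrac_relP[N HN]; apply/hfrac_relP.
exists (M + N + (val y).2)%N; rewrite !exprD.
set a := (val x).1; set b := (val y).1; set c := (val z).1.
have := gen_idealD (gen_idealM (p ^+ N * p ^+ (val z).2) HM)
                   (gen_idealM (p ^+ M * p ^+ (val x).2) HN).
by congr (gen_ideal s _); ring.
Qed.

Canonical hfrac_equiv :=
  EquivRel hfrac_rel hfrac_rel_refl hfrac_rel_sym hfrac_rel_trans.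

Definition chart := {eq_quot hfrac_equiv}.
HB.instance Definition _ := Choice.on chart.
HB.instance Definition _ := EqQuotient.on chart.

Lemma chart_eqP x y : reflect
  (exists N, gen_ideal s
     (p ^+ N * ((val x).1 * p ^+ (val y).2 - (val y).1 * p ^+ (val x).2)))
  (\pi_chart x == \pi_chart y).
Proof. by rewrite eqmodE; apply: hfrac_relP. Qed.

Fact hfrac_add_proof x y :
  (val x).1 * p ^+ (val y).2 + (val y).1 * p ^+ (val x).2
    \is (((val x).2 + (val y).2) * hform_deg f)%N.-homog for (wdeg w).
Proof.
rewrite mulnDl; apply: rpredD.
  apply: dhomogM (valP x) _; rewrite mulnC.
  exact: dhomogMn (hform_homog f).
rewrite addnC; apply: dhomogM (valP y) _; rewrite mulnC.
exact: dhomogMn (hform_homog f).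
Qed.

Fact hfrac_opp_proof x :
  - (val x).1 \is ((val x).2 * hform_deg f)%N.-homog for (wdeg w).
Proof. by rewrite rpredN; apply: valP x. Qed.

Fact hfrac_mul_proof x y :
  (val x).1 * (val y).1
    \is (((val x).2 + (val y).2) * hform_deg f)%N.-homog for (wdeg w).
Proof. by rewrite mulnDl; apply: dhomogM (valP x) (valP y). Qed.

Fact hfrac_const_proof (c : k) :
  c%:MP_[n] \is (0 * hform_deg f)%N.-homog for (wdeg w).
Proof. by rewrite mul0n -[_%:MP]mulr1 mul_mpolyC; exact: rpredZ (dhomog1 _ _). Qed.

Definition hfrac_add x y : hfrac :=
  exist _ ((val x).1 * p ^+ (val y).2 + (val y).1 * p ^+ (val x).2,
           ((val x).2 + (val y).2)%N) (hfrac_add_proof x y).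

Definition hfrac_opp x : hfrac :=
  exist _ (- (val x).1, (val x).2) (hfrac_opp_proof x).

Definition hfrac_mul x y : hfrac :=
  exist _ ((val x).1 * (val y).1, ((val x).2 + (val y).2)%N)
    (hfrac_mul_proof x y).

Definition hfrac_const (c : k) : hfrac :=
  exist _ (c%:MP_[n], 0%N) (hfrac_const_proof c).

Definition chart_add (u v : chart) : chart :=
  \pi_chart (hfrac_add (repr u) (repr v)).
Definition chart_opp (u : chart) : chart := \pi_chart (hfrac_opp (repr u)).
Definition chart_mul (u v : chart) : chart :=
  \pi_chart (hfrac_mul (repr u) (repr v)).
Definition chart_const (c : k) : chart := \pi_chart (hfrac_const c).

Lemma repr_chart x : exists N, gen_ideal s
  (p ^+ N * ((val (repr (\pi_chart x))).1 * p ^+ (val x).2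
             - (val x).1 * p ^+ (val (repr (\pi_chart x))).2)).
Proof. by apply/chart_eqP; rewrite reprK. Qed.

Lemma chart_addE x y :
  chart_add (\pi_chart x) (\pi_chart y) = \pi_chart (hfrac_add x y).
Proof.
apply/eqP/chart_eqP => /=.
have [M HM] := repr_chart x; have [N HN] := repr_chart y.
move: HM HN; set x' := repr _; set y' := repr _ => HM HN.
exists (M + N)%N; rewrite !exprD.
have := gen_idealD
  (gen_idealM (p ^+ N * p ^+ (val y).2 * p ^+ (val y').2) HM)
  (gen_idealM (p ^+ M * p ^+ (val x).2 * p ^+ (val x').2) HN).
by congr (gen_ideal s _); apply: hfrac_add_id.
Qed.

Lemma chart_oppE x : chart_opp (\pi_chart x) = \pi_chart (hfrac_opp x).
Proof.
apply/eqP/chart_eqP => /=; have [N HN] := repr_chart x; exists N.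
by have := gen_idealM (-1) HN; congr (gen_ideal s _); apply: hfrac_opp_id.
Qed.

Lemma chart_mulE x y :
  chart_mul (\pi_chart x) (\pi_chart y) = \pi_chart (hfrac_mul x y).
Proof.
apply/eqP/chart_eqP => /=.
have [M HM] := repr_chart x; have [N HN] := repr_chart y.
move: HM HN; set x' := repr _; set y' := repr _ => HM HN.
exists (M + N)%N; rewrite !exprD.
have := gen_idealD
  (gen_idealM (p ^+ N * (val y').1 * p ^+ (val y).2) HM)
  (gen_idealM (p ^+ M * (val x).1 * p ^+ (val x').2) HN).
by congr (gen_ideal s _); apply: hfrac_mul_id.
Qed.

Lemma chart_eq0 x y :
  (val x).1 * p ^+ (val y).2 = (val y).1 * p ^+ (val x).2 ->
  \pi_chart x = \pi_chart y.
Proof.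
move=> E; apply/eqP/chart_eqP; exists 0%N.
by rewrite E subrr mulr0; apply: gen_ideal0.
Qed.

Lemma chart_addA : associative chart_add.
Proof.
have id (R : comPzRingType) (a b c u v w' : R) :
    (a * (v * w') + (b * w' + c * v) * u) * (u * v * w') =
    ((a * v + b * u) * w' + c * (u * v)) * (u * (v * w')). by ring.
elim/quotW=> x; elim/quotW=> y; elim/quotW=> z.
rewrite (chart_addE y z) (chart_addE x y) !chart_addE.
by apply: chart_eq0; rewrite /= !exprD; apply: id.
Qed.

Lemma chart_addC : commutative chart_add.
Proof.
have id (R : comPzRingType) (a b u v : R) :
    (a * v + b * u) * (v * u) = (b * u + a * v) * (u * v). by ring.
elim/quotW=> x; elim/quotW=> y; rewrite !chart_addE.
by apply: chart_eq0; rewrite /= !exprD; apply: id.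
Qed.

Lemma chart_add0 : left_id (chart_const 0) chart_add.
Proof.
elim/quotW=> x; rewrite !chart_addE.
by apply: chart_eq0; rewrite /= mpolyC0 mul0r add0r add0n expr0 mulr1.
Qed.

Lemma chart_addN : left_inverse (chart_const 0) chart_opp chart_add.
Proof.
elim/quotW=> x; rewrite chart_oppE chart_addE.
by apply: chart_eq0; rewrite /= mpolyC0 mulNr addNr !mul0r.
Qed.

HB.instance Definition _ :=
  GRing.isZmodule.Build chart chart_addA chart_addC chart_add0 chart_addN.

Lemma chart_mulA : associative chart_mul.
Proof.
have id (R : comPzRingType) (a b c u v w' : R) :
    a * (b * c) * (u * v * w') = a * b * c * (u * (v * w')). by ring.
elim/quotW=> x; elim/quotW=> y; elim/quotW=> z.
rewrite (chart_mulE y z) (chart_mulE x y) !chart_mulE.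
by apply: chart_eq0; rewrite /= !exprD; apply: id.
Qed.

Lemma chart_mulC : commutative chart_mul.
Proof.
have id (R : comPzRingType) (a b u v : R) :
    a * b * (v * u) = b * a * (u * v). by ring.
elim/quotW=> x; elim/quotW=> y; rewrite !chart_mulE.
by apply: chart_eq0; rewrite /= !exprD; apply: id.
Qed.

Lemma chart_mul1 : left_id (chart_const 1) chart_mul.
Proof.
elim/quotW=> x; rewrite !chart_mulE.
by apply: chart_eq0; rewrite /= mpolyC1 mul1r add0n.
Qed.

Lemma chart_mulDl : left_distributive chart_mul chart_add.
Proof.
have id (R : comPzRingType) (a b c u v w' : R) :
    (a * v + b * u) * c * (u * w' * (v * w')) =
    (a * c * (v * w') + b * c * (u * w')) * (u * v * w'). by ring.
elim/quotW=> x; elim/quotW=> y; elim/quotW=> z.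
rewrite (chart_addE x y) (chart_mulE x z) (chart_mulE y z).
rewrite chart_mulE chart_addE.
by apply: chart_eq0; rewrite /= !exprD; apply: id.
Qed.

HB.instance Definition _ := GRing.Zmodule_isComPzRing.Build chart
  chart_mulA chart_mulC chart_mul1 chart_mulDl.

Lemma chart_const_is_nmod_morphism : nmod_morphism chart_const.
Proof.
split=> // c d; rewrite [RHS]chart_addE; apply: chart_eq0 => /=.
by rewrite mpolyCD !addn0 expr0 !mulr1.
Qed.

Lemma chart_const_is_monoid_morphism : monoid_morphism chart_const.
Proof.
split=> // c d; rewrite [RHS]chart_mulE; apply: chart_eq0 => /=.
by rewrite mpolyCM !addn0.
Qed.

HB.instance Definition _ :=
  GRing.isNmodMorphism.Build k chart chart_const chart_const_is_nmod_morphism.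
HB.instance Definition _ :=
  GRing.isMonoidMorphism.Build k chart chart_const
    chart_const_is_monoid_morphism.

Definition chart_alg : kalg k := @KAlg k chart chart_const.

End Chart.

(* A k-scheme is smooth when each of its points has an affine open
   neighbourhood Spec A with A a smooth k-algebra; the neighbourhood may be
   taken in the base of the sets D_+(f), a localization of a smooth algebra
   being smooth. *)
Definition smooth_proj (k : fieldType) (n : nat) (w : 'I_n -> nat)
    (s : seq {mpoly k[n]}) : Prop :=
  forall x : proj_point w s,
    exists f : hform k w, ~ x f /\ smooth_alg (chart_alg s f).

Definition weights1 (m n : nat) (i : 'I_3) : nat := nth 0%N [:: 1%N; m; n] i.

Definition fermat_poly (k : fieldType) (a m n : nat) : {mpoly k[3]} :=
  'X_0 ^+ (a * m * n) + 'X_1 ^+ (a * n) - 'X_2 ^+ (a * m).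

(* Main.v *)
From HB Require Import structures.
Require Import Defs.
From mathcomp Require Import all_boot all_algebra generic_quotient.
From mathcomp Require Import boolp mpoly.
From mathcomp Require Import ring zify.

(** The proof is a Jacobian criterion in homogeneous coordinates.  Write
    S = k[x_0, x_1, x_2] and let F be the Fermat polynomial.  Two kinds of
    points are to be covered.  Where x_0 <> 0, the chart D_+(x_0) is used.
    Where x_0 = 0, the equation becomes x_1^(an) = x_2^(am), so that x_1 and
    x_2 vanish together; as they cannot all vanish, the point lies in
    D_+(x_1 x_2) ([fermat_point]).

    Both charts D_+(f) have two properties.
    - S_f contains a unit of degree 1: x_0 on the first chart, and
      x_1^b / x_2^c with m b - n c = 1 on the second, which is where the
      coprimality of the weights enters.  Hence the G_m-action on Spec S_f is
      free with a slice, and (S/F)_(f) is the coordinate ring of the slice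
      where this unit t / f^e equals 1:
        (S/F)_(f) = S[W] / (F, W f - 1, W^e t - 1).
      This is the finite presentation ([chart_presentation]).
    - A power of f lies in the Jacobian ideal of F: x_0^(amn-1) is a multiple
      of dF/dx_0 and (x_1 x_2)^(an-1) is a multiple of dF/dx_1.  The factors
      amn and an are inverted here, which needs characteristic 0.

    These two properties imply that the chart is formally smooth
    ([chart_hypersurface_smooth]).  Let B -> B' be a square-zero extension and
    let a B'-point of the slice be given.  Lift its coordinates to B
    arbitrarily; one Newton step along the gradient makes F vanish
    ([newton_lift]), since f, hence some combination of the partial
    derivatives, is a unit; finally t / f^e takes a value in 1 + J, J being the
    kernel of B -> B', and rescaling each coordinate by a power of that value
    according to its weight brings the point back to the slice without
    disturbing F = 0 ([weighted_scaling]). *)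

Set Implicit Arguments.
Unset Strict Implicit.
Unset Printing Implicit Defensive.

Import GRing.Theory.
Local Open Scope ring_scope.
Local Open Scope quotient_scope.

(** * Homomorphisms out of polynomial rings *)

Section PolynomialRings.
Variable k : fieldType.

Lemma mpoly_alg_ind (n : nat) (P : {mpoly k[n]} -> Prop) :
  (forall c, P c%:MP) -> (forall i, P 'X_i) ->
  (forall g h, P g -> P h -> P (g + h)) ->
  (forall g h, P g -> P h -> P (g * h)) -> forall g, P g.
Proof.
move=> PC PX PD PM g; rewrite (mpolyE g).
have P0 : P 0 by rewrite -mpolyC0.
have P1 : P 1 by rewrite -mpolyC1.
apply: (big_ind P P0 PD) => m _; rewrite -mul_mpolyC mpolyXE_id; apply: (PM) => //.
apply: (big_ind P P1 PM) => i _; elim: (m i) => [|j IH]; rewrite ?expr0 // exprS.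
exact: PM.
Qed.

(** The zero algebra needs a separate argument because [mmap] evaluates only in
    nontrivial rings, whereas a [kalg] may be trivial. *)
Lemma kalg_eval (B : kalg k) (n : nat) (b : 'I_n -> B) :
  exists ev : {rmorphism kalg_mpoly k n -> B},
    kalg_hom ev /\ forall i, ev 'X_i = b i.
Proof.
have [B0|Bnz] := eqVneq (1 : B) 0.
  have B00 (x : B) : x = 0 by rewrite -[x]mul1r B0 mul0r.
  pose z (_ : kalg_mpoly k n) : B := 0.
  have zD : nmod_morphism z by split=> // x y; rewrite /z addr0.
  have zM : monoid_morphism z by split=> [|x y]; rewrite /z ?mulr0.
  pose zA := GRing.isNmodMorphism.Build _ _ z zD.
  pose zB := GRing.isMonoidMorphism.Build _ _ z zM.
  pose ev : {rmorphism kalg_mpoly k n -> B} := HB.pack z zA zB.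
  by exists ev; split=> [c|i]; rewrite [LHS]B00 [RHS]B00.
pose nzB := GRing.PzSemiRing_isNonZero.Build B Bnz.
pose BN : comNzRingType := HB.pack (GRing.ComPzRing.sort B) nzB.
pose inB : {rmorphism k -> BN} := kalg_in B.
exists (mmap inB b : {rmorphism {mpoly k[n]} -> BN}); split=> [c|i].
  exact: (@mmapC n k BN b inB c).
by rewrite [LHS](@mmapX n k BN b inB) mmap1U.
Qed.

Lemma kalg_hom_ext (B : kalg k) (n : nat)
    (e e' : {rmorphism kalg_mpoly k n -> B}) :
  kalg_hom e -> kalg_hom e' -> (forall i, e 'X_i = e' 'X_i) -> forall g, e g = e' g.
Proof.
move=> eC e'C eX; apply: mpoly_alg_ind => [c|i|g h Eg Eh|g h Eg Eh].
- by rewrite [LHS]eC [RHS]e'C.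
- exact: eX.
- by rewrite [LHS]rmorphD [RHS]rmorphD; congr (_ + _).
- by rewrite [LHS]rmorphM [RHS]rmorphM; congr (_ * _).
Qed.

(** Both sides are algebra homomorphisms in disguise: by the Leibniz rule the
    right-hand side is multiplicative, the quadratic terms vanishing, so that it
    suffices to compare them on constants and variables. *)
Lemma taylor1 (B : kalg k) (n : nat) (e e' : {rmorphism kalg_mpoly k n -> B}) :
  kalg_hom e -> kalg_hom e' ->
  (forall i j, (e' 'X_i - e 'X_i) * (e' 'X_j - e 'X_j) = 0) ->
  forall g : {mpoly k[n]},
    e' g = e g + \sum_(i < n) e g^`M(i) * (e' 'X_i - e 'X_i).
Proof.
move=> eC e'C dd; pose d i := e' 'X_i - e 'X_i.
have DD (F G : 'I_n -> B) : (\sum_i F i * d i) * (\sum_i G i * d i) = 0.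
  rewrite big_distrlr /= big1 // => i _; rewrite big1 // => j _.
  by rewrite mulrACA dd mulr0.
apply: mpoly_alg_ind => [c|i|g h Eg Eh|g h Eg Eh].
- rewrite big1 => [|i _]; last by rewrite mderivC rmorph0 mul0r.
  by rewrite addr0 [LHS]e'C [RHS]eC.
- rewrite (bigD1 i) //= big1 => [|j ij]; last first.
    by rewrite mderivX mnm1E eq_sym (negPf ij) scale0r rmorph0 mul0r.
  rewrite mderivX mnm1E eqxx scale1r addr0 -[X in (X - _)%MM]add0m addmK mpolyX0.
  by rewrite rmorph1 mul1r addrC subrK.
- rewrite [LHS]rmorphD Eg Eh [e (g + h)]rmorphD addrACA -big_split /=.
  congr (_ + _); apply: eq_bigr => i _.
  by rewrite mderivD [in RHS]rmorphD mulrDl.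
- rewrite [LHS]rmorphM Eg Eh mulrDl !mulrDr DD addr0 [e (g * h)]rmorphM -addrA.
  congr (_ + _); rewrite mulr_sumr mulr_suml -big_split /=.
  apply: eq_bigr => i _; rewrite mderivM [in RHS]rmorphD !rmorphM mulrDl.
  by rewrite addrC mulrA mulrAC.
Qed.

Lemma mwiden_var (n : nat) (i : 'I_n) :
  mwiden 'X_i = 'X_(lift ord_max i) :> {mpoly k[n.+1]}.
Proof.
rewrite mwidenX mnmwiden1; congr 'X_[U_(_)].
by apply: val_inj; rewrite /= /bump leqNgt ltn_ord.
Qed.

Lemma mpolyS_ind (n : nat) (P : {mpoly k[n.+1]} -> Prop) :
  (forall c, P c%:MP) -> (forall i, P (mwiden 'X_i)) -> P 'X_ord_max ->
  (forall g h, P g -> P h -> P (g + h)) ->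
  (forall g h, P g -> P h -> P (g * h)) -> forall g, P g.
Proof.
move=> PC PX PY PD PM; apply: mpoly_alg_ind => // i.
by have [j ->|->//] := unliftP ord_max i; rewrite -mwiden_var.
Qed.

Lemma kalg_evalS (B : kalg k) (n : nat) (e : {rmorphism kalg_mpoly k n -> B})
    (c : B) :
  kalg_hom e -> exists e' : {rmorphism kalg_mpoly k n.+1 -> B},
    [/\ kalg_hom e', forall g, e' (mwiden g) = e g & e' 'X_ord_max = c].
Proof.
move=> eC.
have [e' [e'C e'X]] :=
  kalg_eval (fun i => if unlift ord_max i is Some j then e 'X_j else c).
exists e'; split=> //; last by rewrite e'X unlift_none.
apply: mpoly_alg_ind => [a|i|g h Eg Eh|g h Eg Eh].
- by rewrite mwidenC [LHS]e'C [RHS]eC.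
- by rewrite mwiden_var e'X liftK.
- by rewrite mwidenD [LHS]rmorphD [RHS]rmorphD; congr (_ + _).
- by rewrite mwidenM [LHS]rmorphM [RHS]rmorphM; congr (_ * _).
Qed.

(** Sums are taken within one degree only, so that a property that mentions the
    degree can be proved for homogeneous polynomials without ever speaking of
    the inhomogeneous ones. *)
Lemma dhomog_alg_ind (n : nat) (w : 'I_n -> nat) (T : {mpoly k[n]} -> nat -> Prop) :
  (forall c, T c%:MP 0%N) -> (forall i, T 'X_i (w i)) ->
  (forall j, T 0 j) ->
  (forall j g h, T g j -> T h j -> T (g + h) j) ->
  (forall i j g h, T g i -> T h j -> T (g * h) (i + j)%N) ->
  forall g j, g \is j.-homog for (wdeg w) -> T g j.
Proof.
move=> TC TX T0 TD TM g j /dhomogP gj; rewrite (mpolyE g) big_seq.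
apply: (big_ind (T^~ j)) => [//|x y|m mg]; first exact: TD.
have <- : wdeg w m = j by apply: gj.
rewrite -mul_mpolyC -[X in T _ X]add0n; apply: (TM) => //.
rewrite mpolyXE_id /wdeg.
elim/big_rec2: _ => [|i d q _ IH]; first by rewrite -mpolyC1.
apply: (TM) => //; elim: (m i) => [|e IHe].
  by rewrite expr0 muln0 -mpolyC1.
by rewrite exprS mulnS; apply: TM.
Qed.

Lemma dhomog_var (n : nat) (w : 'I_n -> nat) (i : 'I_n) (j : nat) :
  ('X_i ^+ j : {mpoly k[n]}) \is (w i * j)%N.-homog for (wdeg w).
Proof.
apply: dhomogMn; rewrite dhomogX /= /wdeg (bigD1 i) //= mnm1E eqxx muln1.
by rewrite big1 ?addn0 // => l; rewrite mnm1E eq_sym => /negPf->; rewrite muln0.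
Qed.

End PolynomialRings.

(** * Finitely generated ideals, quotients and square-zero extensions *)

Section Ideals.
Variable R : comPzRingType.

Lemma gen_ideal_mem (s : seq R) x : x \in s -> gen_ideal s x.
Proof.
move=> xs; have ix : (index x s < size s)%N by rewrite index_mem.
exists (fun i => (i == index x s)%:R).
rewrite (bigD1 (Ordinal ix)) //= big1 => [|j jx]; last first.
  by rewrite -(inj_eq val_inj) /= in jx; rewrite (negPf jx) mul0r.
by rewrite eqxx mul1r addr0 nth_index.
Qed.

Lemma gen_ideal_morph (R' : comPzRingType) (h : {rmorphism R -> R'}) s s' :
  (forall x, x \in s -> gen_ideal s' (h x)) ->
  forall x, gen_ideal s x -> gen_ideal s' (h x).
Proof.
move=> hs x [c ->]; rewrite rmorph_sum.
apply: (big_ind (gen_ideal s')) => [|u v|i _]; first exact: gen_ideal0.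
  exact: gen_idealD.
by rewrite rmorphM; apply: gen_idealM; apply: hs; apply: mem_nth.
Qed.

Lemma gen_ideal_vanish (R' : comPzRingType) (h : {rmorphism R -> R'}) s :
  (forall x, x \in s -> h x = 0) -> forall x, gen_ideal s x -> h x = 0.
Proof.
move=> hs x [c ->]; rewrite rmorph_sum big1 // => i _.
by rewrite rmorphM [h s`_i]hs ?mulr0 ?mem_nth.
Qed.
End Ideals.

(** The universal property of the quotient of P by the kernel of p. *)
Lemma factor_through_surj (P A B : comPzRingType) (p : {rmorphism P -> A})
    (q : {rmorphism P -> B}) :
  (forall a, exists x, p x = a) -> (forall x, p x = 0 -> q x = 0) ->
  exists g : {rmorphism A -> B}, forall x, g (p x) = q x.
Proof.
move=> psurj pq.
have [l lK] := choice psurj.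
have qeq x y : p x = p y -> q x = q y.
  by move=> E; apply/eqP; rewrite -subr_eq0 -rmorphB pq // rmorphB E subrr.
pose g a := q (l a).
have gD : nmod_morphism g.
  split=> [|x y]; first by rewrite -[RHS](rmorph0 q); apply: qeq; rewrite lK rmorph0.
  by rewrite /g -rmorphD; apply: qeq; rewrite rmorphD !lK.
have gM : monoid_morphism g.
  split=> [|x y]; first by rewrite -[RHS](rmorph1 q); apply: qeq; rewrite lK rmorph1.
  by rewrite /g -rmorphM; apply: qeq; rewrite rmorphM !lK.
pose gA := GRing.isNmodMorphism.Build _ _ g gD.
pose gB := GRing.isMonoidMorphism.Build _ _ g gM.
pose gg : {rmorphism A -> B} := HB.pack g gA gB.
by exists gg => x; apply: qeq; rewrite lK.
Qed.

(** Units lift along a square-zero extension, with a prescribed lift of the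
    inverse: for any lift y of the inverse, h = 1 - x y squares to zero, and so
    y (1 + h) is inverse to x. *)
Lemma unit_lift (B B' : comPzRingType) (p : {rmorphism B -> B'}) :
  (forall b', exists b, p b = b') ->
  (forall x y, p x = 0 -> p y = 0 -> x * y = 0) ->
  forall x y', p x * y' = 1 -> exists y, x * y = 1 /\ p y = y'.
Proof.
move=> psurj psq x y' xy'; have [y py] := psurj y'.
have p0 : p (1 - x * y) = 0 by rewrite rmorphB rmorphM py xy' rmorph1 subrr.
exists (y * (1 + (1 - x * y))); split; last first.
  by rewrite rmorphM rmorphD p0 rmorph1 addr0 mulr1.
have h2 := psq _ _ p0 p0; rewrite -[RHS]subr0 -h2; ring.
Qed.

(** * Fractions on an affine chart *)

Section Chart.
Variables (k : fieldType) (n : nat) (w : 'I_n -> nat) (s : seq {mpoly k[n]}).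
Variable f : hform k w.
Local Notation p := (hform_poly f).
Local Notation d := (hform_deg f).

(** The relation c = g / f^e.  A relation, rather than a function of g and e,
    hides the proof that g has degree e deg f, which would otherwise occur in
    every equation between fractions. *)
Definition chart_frac (c : chart s f) (g : {mpoly k[n]}) (e : nat) : Prop :=
  exists2 y : hfrac f, val y = (g, e) & c = \pi_(chart s f) y.

Lemma chart_frac_mk g e :
  g \is (e * d)%N.-homog for (wdeg w) -> exists c, chart_frac c g e.
Proof.
move=> H; pose y : hfrac f := exist _ (g, e) H.
by exists (\pi_(chart s f) y); exists y.
Qed.

Lemma chart_frac_repr c : exists g e,
  g \is (e * d)%N.-homog for (wdeg w) /\ chart_frac c g e.
Proof.
elim/quotW: c => y; exists (val y).1, (val y).2; split; first exact: valP y.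
by exists y => //; case: (val y).
Qed.

Lemma chart_frac_const c : chart_frac (kalg_in (chart_alg s f) c) c%:MP 0.
Proof. by exists (hfrac_const f c). Qed.

Lemma chart_frac1 : chart_frac 1 1 0.
Proof. by exists (hfrac_const f 1); rewrite ?mpolyC1. Qed.

Lemma chart_fracM c c' g g' e e' : chart_frac c g e -> chart_frac c' g' e' ->
  chart_frac (c * c') (g * g') (e + e').
Proof.
move=> [y yE ->] [y' y'E ->]; exists (hfrac_mul y y'); last exact: chart_mulE.
by rewrite /= yE y'E.
Qed.

Lemma chart_fracX c g e j : chart_frac c g e ->
  chart_frac (c ^+ j) (g ^+ j) (e * j).
Proof.
move=> cg; elim: j => [|j IH]; first by rewrite !expr0 muln0; apply: chart_frac1.
by rewrite !exprS mulnS; apply: chart_fracM.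
Qed.

Lemma chart_frac_inj c c' g g' e e' : chart_frac c g e -> chart_frac c' g' e' ->
  g * p ^+ e' = g' * p ^+ e -> c = c'.
Proof.
by move=> [y yE ->] [y' y'E ->] E; apply: chart_eq0; rewrite yE y'E.
Qed.

Lemma chart_frac_eq c g g' e e' : g' \is (e' * d)%N.-homog for (wdeg w) ->
  chart_frac c g e -> g * p ^+ e' = g' * p ^+ e -> chart_frac c g' e'.
Proof.
by move=> /chart_frac_mk[c' H'] H E; rewrite (chart_frac_inj H H' E).
Qed.

Lemma chart_fracD c c' g g' e : chart_frac c g e -> chart_frac c' g' e ->
  chart_frac (c + c') (g + g') e.
Proof.
move=> [y yE ->] [y' y'E ->].
have H : g + g' \is (e * d)%N.-homog for (wdeg w).
  by apply: rpredD; [move: (valP y)|move: (valP y')]; rewrite ?yE ?y'E.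
exists (exist _ (g + g', e) H) => //.
rewrite [LHS]chart_addE; apply: chart_eq0; rewrite /= yE y'E exprD /=; ring.
Qed.

Lemma chart_frac0 c g e : chart_frac c g e ->
  c = 0 <-> exists N, gen_ideal s (p ^+ N * g).
Proof.
move=> [y yE ->].
split=> [/eqP/(chart_eqP s y (hfrac_const f 0))[N]|[N H]].
  by rewrite yE /= mpolyC0 mul0r subr0 expr0 mulr1; exists N.
apply/eqP/(chart_eqP s y (hfrac_const f 0)); exists N.
by rewrite yE /= mpolyC0 mul0r subr0 expr0 mulr1.
Qed.
End Chart.

(** * Presentation of a chart with a unit of degree one *)

Section Presentation.
Variables (k : fieldType) (n : nat) (w : 'I_n -> nat) (s : seq {mpoly k[n]}).
Variable f : hform k w.
Local Notation p := (hform_poly f).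
Local Notation d := (hform_deg f).
Local Notation W := ('X_ord_max : {mpoly k[n.+1]}).

(** The closed subscheme of A^(n+1) where s = 0, the last coordinate W is the
    inverse of f, and the fraction t / f^e equals 1. *)
Definition slice_eqs (t : {mpoly k[n]}) (e : nat) : seq {mpoly k[n.+1]} :=
  [:: W * mwiden p - 1, W ^+ e * mwiden t - 1 & [seq mwiden g | g <- s]].

Variables (t u : {mpoly k[n]}) (e e' : nat).
Hypothesis s_homog : forall g, g \in s -> exists j, g \is j.-homog for (wdeg w).
Hypothesis e'_gt0 : (0 < e')%N.
Hypothesis t_homog : t \is (1 + e * d)%N.-homog for (wdeg w).
Hypothesis u_homog : u \is (e' * d - 1)%N.-homog for (wdeg w).
Hypothesis tu : t * u = p ^+ (e + e').

Local Notation I := (slice_eqs t e).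
Local Notation "x === y" := (gen_ideal I (x - y)) (at level 70).

Let c_refl x : x === x. Proof. by rewrite subrr; apply: gen_ideal0. Qed.
Let c_sym x y : x === y -> y === x.
Proof. by move=> H; rewrite -opprB -mulN1r; apply: gen_idealM. Qed.
Let c_trans y x z : x === y -> y === z -> x === z.
Proof. by move=> H H'; have := gen_idealD H H'; rewrite addrA subrK. Qed.
Let c_add x x' y y' : x === x' -> y === y' -> x + y === x' + y'.
Proof. by move=> H H'; rewrite opprD addrACA; apply: gen_idealD. Qed.
Let c_mul x x' y y' : x === x' -> y === y' -> x * y === x' * y'.
Proof.
move=> H H'; have -> : x * y - x' * y' = y * (x - x') + x' * (y - y') by ring.
by apply: gen_idealD; apply: gen_idealM.
Qed.
Let c_exp x x' j : x === x' -> x ^+ j === x' ^+ j.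
Proof. by move=> H; elim: j => [|j IH]; rewrite ?expr0 // !exprS; apply: c_mul. Qed.

Let wp : W * mwiden p === 1.
Proof. by apply: gen_ideal_mem; rewrite inE eqxx. Qed.
Let wt : W ^+ e * mwiden t === 1.
Proof. by apply: gen_ideal_mem; rewrite !inE eqxx orbT. Qed.
Let wpX j : W ^+ j * mwiden p ^+ j === 1.
Proof. by rewrite -exprMn -[X in _ === X](expr1n _ j); apply: c_exp. Qed.
Let wu : W ^+ e' * mwiden u === 1.
Proof.
have H := c_mul wt (c_refl (W ^+ e' * mwiden u)).
rewrite mul1r in H; apply: c_trans (c_sym H) _.
rewrite mulrACA -exprD -mwidenM tu rmorphXn; exact: wpX.
Qed.

Let wu_deg j : (j + j * (e' * d - 1) = e' * j * d)%N.
Proof.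
have : (0 < e' * d)%N by rewrite muln_gt0 e'_gt0 hform_deg_gt0.
by rewrite mulnAC; case: (e' * d)%N => // D _; rewrite subn1 mulSn [(j * _)%N]mulnC.
Qed.

(** The map sends x_i to x_i / tau^(w_i) and W to tau^d / f, where d = deg f
    and tau = t / f^e; the inverse of tau is u / f^e' (as e' > 0, the truncated
    subtraction in the degree of u is exact).  Hence a homogeneous g of degree j
    goes to g / tau^j.  For the kernel, every polynomial is congruent
    modulo the slice equations to some h W^j with h in S homogeneous of degree
    j d, and that element goes to the fraction h / f^j; when the fraction
    vanishes, f^N h is in (s), hence so is h up to the unit f. *)
Lemma chart_presentation :
  exists q : {rmorphism kalg_mpoly k n.+1 -> chart_alg s f},
    [/\ kalg_hom q, forall a, exists g, q g = a
      & forall g, q g = 0 <-> gen_ideal I g].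
Proof.
have xhom i : 'X_i * u ^+ w i \is (e' * w i * d)%N.-homog for (wdeg w).
  rewrite -wu_deg [X in (_ + X)%N]mulnC; apply: dhomogM (dhomogMn _ u_homog).
  by have := @dhomog_var k _ w i 1; rewrite expr1 muln1.
have [xi xiE] := choice (fun i => chart_frac_mk s (xhom i)).
have whom : t ^+ d \is ((1 + e * d) * d)%N.-homog for (wdeg w).
  exact: dhomogMn t_homog.
have [om omE] := chart_frac_mk s whom.
have [q0 [q0C q0X]] := @kalg_eval k (chart_alg s f) n xi.
have [q [qC qg qW]] := @kalg_evalS k (chart_alg s f) n q0 om q0C.
(* g goes to g / tau^j = g u^j / f^(e' j). *)
have qhom g j : g \is j.-homog for (wdeg w) ->
    chart_frac (q (mwiden g) : chart s f) (g * u ^+ j) (e' * j).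
  move: g j; apply: dhomog_alg_ind => [c|i|j|j g h Hg Hh|i j g h Hg Hh].
  - rewrite muln0 expr0 mulr1 mwidenC; have -> := qC c.
    exact: chart_frac_const.
  - by rewrite qg q0X.
  - rewrite mwiden0 rmorph0 mul0r.
    have [c c0] := chart_frac_mk s (dhomog0 k (wdeg w) (e' * j * d)).
    suff <- : c = 0 by [].
    by apply/(chart_frac0 c0); exists 0%N; rewrite mulr0; apply: gen_ideal0.
  - by rewrite mwidenD mulrDl [q _]rmorphD; apply: chart_fracD.
  - rewrite mwidenM [q _]rmorphM exprD mulnDr mulrACA; exact: chart_fracM.
(* The exponents cancel because tau has degree 1: g W^j goes to
   g / tau^(j d) * (tau^d / f)^j. *)
have qPsi g j c : g \is (j * d)%N.-homog for (wdeg w) -> chart_frac c g j ->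
    q (mwiden g * W ^+ j) = c.
  move=> gj cg; rewrite [LHS]rmorphM rmorphXn qW.
  have H := chart_fracM (qhom _ _ gj) (chart_fracX j omE).
  apply: (chart_frac_inj H cg).
  have tuX : t ^+ d ^+ j * u ^+ (j * d) = p ^+ ((e + e') * (j * d)).
    by rewrite -exprM mulnC -exprMn tu -exprM.
  have -> : g * u ^+ (j * d) * t ^+ d ^+ j * p ^+ j =
            g * (t ^+ d ^+ j * u ^+ (j * d)) * p ^+ j by ring.
  rewrite tuX -mulrA -exprD; congr (_ * p ^+ _); ring.
have qI g : gen_ideal I g -> q g = 0.
  apply: gen_ideal_vanish => {}g; rewrite !inE => /or3P[/eqP->|/eqP->|/mapP[h hs ->]].
  - apply/eqP; rewrite rmorphB rmorph1 subr_eq0; apply/eqP.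
    have ph : p \is (1 * d)%N.-homog for (wdeg w) by rewrite mul1n hform_homog.
    rewrite mulrC -[W]expr1; apply: (qPsi _ _ _ ph).
    by apply: chart_frac_eq ph (chart_frac1 s f) _; rewrite mul1r expr0 mulr1.
  - apply/eqP; rewrite rmorphB rmorph1 subr_eq0 rmorphM rmorphXn qW; apply/eqP.
    have H := chart_fracM (chart_fracX e omE) (qhom _ _ t_homog).
    apply: (chart_frac_inj H (chart_frac1 s f)).
    have tuX : t ^+ d ^+ e * t * u ^+ (1 + e * d) = p ^+ ((e + e') * (1 + e * d)).
      by rewrite -exprM mulnC -exprSr -exprMn tu -exprM.
    rewrite mulr1 mul1r mulrA tuX; congr (_ ^+ _); ring.
  - have [j hj] := s_homog hs.
    apply/(chart_frac0 (qhom _ _ hj)); exists 0%N.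
    by rewrite expr0 mul1r mulrC; apply/gen_idealM/gen_ideal_mem.
have qrep g : exists h j, h \is (j * d)%N.-homog for (wdeg w) /\
    g === mwiden h * W ^+ j.
  elim/mpolyS_ind: g => [c|i||g g' [h [j [hh Hh]]] [h' [j' [hh' Hh']]]|
     g g' [h [j [hh Hh]]] [h' [j' [hh' Hh']]]].
  - exists c%:MP, 0%N; rewrite (hfrac_const_proof f); split=> //.
    by rewrite expr0 mulr1 mwidenC; apply: c_refl.
  - exists ('X_i * u ^+ w i), (e' * w i)%N; split=> //.
    have := c_mul (c_refl (mwiden 'X_i)) (c_sym (c_exp (w i) wu)).
    by rewrite expr1n mulr1 mwidenM rmorphXn exprMn -exprM -mulrA [W ^+ _ * _]mulrC.
  - exists (t ^+ d), (1 + e * d)%N; split=> //.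
    have := c_mul (c_refl W) (c_sym (c_exp d wt)).
    rewrite expr1n mulr1.
    have <- // : mwiden (t ^+ d) * W ^+ (1 + e * d) = W * (W ^+ e * mwiden t) ^+ d.
    by rewrite rmorphXn exprMn -exprM exprD expr1; ring.
  - exists (h * p ^+ j' + h' * p ^+ j), (j + j')%N; split.
      rewrite mulnDl; apply: rpredD.
        by apply: dhomogM hh _; rewrite mulnC; apply: dhomogMn (hform_homog f).
      by rewrite addnC; apply: dhomogM hh' _; rewrite mulnC;
        apply: dhomogMn (hform_homog f).
    apply: c_trans (c_add Hh Hh') _.
    have := c_add (c_mul (c_refl (mwiden h * W ^+ j)) (c_sym (wpX j')))
                  (c_mul (c_refl (mwiden h' * W ^+ j')) (c_sym (wpX j))).
    rewrite !mulr1 mwidenD !mwidenM !rmorphXn exprD => H; apply: c_trans H _.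
    set A := (X in X === _); set B := (X in _ === X).
    suff -> : A = B by apply: c_refl.
    by rewrite /A /B; ring.
  - exists (h * h'), (j + j')%N; split.
      by rewrite mulnDl; apply: dhomogM hh hh'.
    by rewrite mwidenM exprD mulrACA; apply: c_mul.
exists q; split=> // [a|g].
  have [g [j [gj ag]]] := chart_frac_repr a.
  by exists (mwiden g * W ^+ j); apply: qPsi gj ag.
split; last exact: qI.
move=> qg0; have [h [j [hh gh]]] := qrep g.
have [c ch] := chart_frac_mk s hh.
have c0 : c = 0.
  rewrite -(qPsi _ _ _ hh ch) -qg0; apply/eqP; rewrite eq_sym -subr_eq0 -rmorphB.
  by rewrite qI.
have [N HN] := (chart_frac0 ch).1 c0.
have {}HN : gen_ideal I (mwiden (p ^+ N * h)).
  apply: gen_ideal_morph HN => x xs; apply: gen_ideal_mem.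
  by rewrite !inE map_f ?orbT.
have H0 : mwiden h * W ^+ j === 0.
  have := c_mul (c_refl (mwiden h * W ^+ j)) (c_sym (wpX N)).
  rewrite mulr1 => H; apply: c_trans H _; rewrite subr0.
  have := gen_idealM (W ^+ (j + N)) HN; congr (gen_ideal _ _).
  by rewrite mwidenM rmorphXn exprD; ring.
by have := c_trans gh H0; rewrite subr0.
Qed.

End Presentation.

(** * Lifting points of a quasi-smooth hypersurface *)

Section FormalSmoothness.
Variable k : fieldType.

Lemma weighted_scaling (B : kalg k) (n : nat) (w : 'I_n -> nat)
    (e e' : {rmorphism kalg_mpoly k n -> B}) (v : B) :
  kalg_hom e -> kalg_hom e' -> (forall i, e' 'X_i = v ^+ w i * e 'X_i) ->
  forall g j, g \is j.-homog for (wdeg w) -> e' g = v ^+ j * e g.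
Proof.
move=> eC e'C eX; apply: dhomog_alg_ind => [c|i|j|j g h Eg Eh|i j g h Eg Eh].
- by rewrite mul1r [LHS]e'C [RHS]eC.
- exact: eX.
- by rewrite !rmorph0 mulr0.
- by rewrite [LHS]rmorphD Eg Eh [e (g + h)]rmorphD mulrDr.
- by rewrite [LHS]rmorphM Eg Eh [e (g * h)]rmorphM exprD mulrACA.
Qed.

(** If e lifts phi, then e(F) has square zero, and shifting the i-th coordinate
    by - c^N e(be_i) e(F), where c is the inverse of e(f), changes e(F) by
    - c^N e(F) sum_i e(be_i dF/dx_i) = - e(F), the term in al F contributing
    only a multiple of e(F)^2. *)
Lemma newton_lift (n : nat) (F f al : {mpoly k[n]}) (be : 'I_n -> {mpoly k[n]})
    (N : nat) (B B' : kalg k) (p : {rmorphism B -> B'})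
    (phi : {rmorphism kalg_mpoly k n -> B'}) (c' : B') :
  f ^+ N = al * F + \sum_(i < n) be i * F^`M(i) ->
  kalg_hom p -> (forall b', exists b, p b = b') ->
  (forall x y, p x = 0 -> p y = 0 -> x * y = 0) ->
  kalg_hom phi -> phi F = 0 -> phi f * c' = 1 ->
  exists psi : {rmorphism kalg_mpoly k n -> B},
    [/\ kalg_hom psi, forall g, p (psi g) = phi g & psi F = 0].
Proof.
move=> jac pC psurj psq phiC phiF phif.
have comp_hom (e : {rmorphism kalg_mpoly k n -> B}) :
    kalg_hom e -> kalg_hom (p \o e : {rmorphism _ -> _}).
  by move=> eC c; rewrite /= eC pC.
have [b bE] := choice (fun i => psurj (phi 'X_i)).
have [e [eC eX]] := kalg_eval b.
have pe g : p (e g) = phi g.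
  by apply: (kalg_hom_ext (comp_hom e eC) phiC) => i; rewrite /= eX bE.
have [c [fc pc]] : exists c, e f * c = 1 /\ p c = c'.
  by apply: (unit_lift psurj psq); rewrite pe.
have peF : p (e F) = 0 by rewrite pe.
have [e' [e'C e'X]] := kalg_eval (fun i => e 'X_i - c ^+ N * e (be i) * e F).
have dE i : e' 'X_i - e 'X_i = - (c ^+ N * e (be i) * e F).
  by rewrite e'X addrAC subrr sub0r.
have pd i : p (e' 'X_i - e 'X_i) = 0 by rewrite dE rmorphN rmorphM peF mulr0 oppr0.
exists e'; split=> // [g|].
  apply: (kalg_hom_ext (comp_hom e' e'C) phiC) => i.
  by rewrite /= -pe; apply/eqP; rewrite -subr_eq0 -rmorphB pd.
rewrite (taylor1 eC e'C) => [|i j]; last exact: psq.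
have FF : e F * e F = 0 by apply: psq.
have -> : \sum_(i < n) e F^`M(i) * (e' 'X_i - e 'X_i) =
    - (c ^+ N * e F) * \sum_(i < n) e (be i) * e F^`M(i).
  by rewrite mulr_sumr; apply: eq_bigr => i _; rewrite dE; ring.
have -> : \sum_(i < n) e (be i) * e F^`M(i) = e f ^+ N - e al * e F.
  rewrite -rmorphXn jac [e (_ + _)]rmorphD rmorphM rmorph_sum [RHS]addrAC subrr add0r.
  by apply: eq_bigr => i _; rewrite rmorphM.
have -> : e F + - (c ^+ N * e F) * (e f ^+ N - e al * e F) =
   e F - (e f ^+ N * c ^+ N) * e F + c ^+ N * e al * (e F * e F) by ring.
by rewrite -exprMn fc expr1n mul1r subrr FF mulr0 addr0.
Qed.

(** The hypotheses say that the cone F = 0 is smooth where f is invertible and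
    that the torus action there has a slice.  Smoothness then descends from the
    cone to the slice, because rescaling retracts the former onto the latter. *)
Lemma chart_hypersurface_smooth (n : nat) (w : 'I_n -> nat) (f : hform k w)
    (F t u al : {mpoly k[n]}) (be : 'I_n -> {mpoly k[n]}) (D e e' N : nat) :
  F \is D.-homog for (wdeg w) ->
  (0 < e')%N ->
  t \is (1 + e * hform_deg f)%N.-homog for (wdeg w) ->
  u \is (e' * hform_deg f - 1)%N.-homog for (wdeg w) ->
  t * u = (f : {mpoly k[n]}) ^+ (e + e') ->
  (f : {mpoly k[n]}) ^+ N = al * F + \sum_(i < n) be i * F^`M(i) ->
  smooth_alg (chart_alg [:: F] f).
Proof.
move=> FD e'0 td ud tu jac; set d := hform_deg f in td ud.
have sh g : g \in [:: F] -> exists j, g \is j.-homog for (wdeg w).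
  by rewrite inE => /eqP->; exists D.
have [q [qC qsurj qker]] := chart_presentation sh e'0 td ud tu.
split.
  by exists n.+1, q; split=> //; exists (slice_eqs [:: F] f t e).
move=> B B' p pC psurj psq h hC.
have qI x : x \in slice_eqs [:: F] f t e -> q x = 0.
  by move=> xI; apply/qker/gen_ideal_mem.
pose phi : {rmorphism kalg_mpoly k n.+1 -> B'} := h \o q.
have phiC : kalg_hom phi by move=> c; rewrite /= qC hC.
have phiI x : x \in slice_eqs [:: F] f t e -> phi x = 0.
  by move=> /qI /= ->; rewrite rmorph0.
set W : {mpoly k[n.+1]} := 'X_ord_max.
have phif : phi (mwiden f) * phi W = 1.
  apply/eqP; rewrite mulrC -rmorphM -subr_eq0 -(rmorph1 phi) -rmorphB.
  by apply/eqP/phiI; rewrite inE eqxx.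
have phit : phi (mwiden t) * phi W ^+ e = 1.
  apply/eqP; rewrite mulrC -rmorphXn -rmorphM -subr_eq0 -(rmorph1 phi) -rmorphB.
  by apply/eqP/phiI; rewrite !inE eqxx orbT.
have phiF : phi (mwiden F) = 0 by apply: phiI; rewrite !inE eqxx !orbT.
pose phi0 : {rmorphism kalg_mpoly k n -> B'} := phi \o @mwiden n k.
have phi0C : kalg_hom phi0 by move=> c; rewrite -[RHS]phiC /phi0 /= mwidenC.
have [e1 [e1C pe1 e1F]] := newton_lift jac pC psurj psq phi0C phiF phif.
have [c [fc pc]] : exists c, e1 f * c = 1 /\ p c = phi W.
  by apply: (unit_lift psurj psq); rewrite pe1.
(* The slice function at the new point, inverted to give the scaling factor. *)
have [v [tv pv]] : exists v, (e1 t * c ^+ e) * v = 1 /\ p v = 1.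
  by apply: (unit_lift psurj psq); rewrite mulr1 rmorphM rmorphXn pe1 pc.
have [e2 [e2C e2X]] := kalg_eval (fun i => v ^+ w i * e1 'X_i).
have scal := weighted_scaling e1C e2C e2X.
set tau := e1 t * c ^+ e in tv.
(* Scaling by v multiplies f by v^d, hence W = 1 / f by tau^d. *)
have [psi [psiC psig psiW]] := kalg_evalS (tau ^+ d * c) e2C.
have ptau : p tau = 1 by rewrite rmorphM rmorphXn pe1 pc.
have ppsi g : p (psi g) = phi g.
  have H : kalg_hom (p \o psi : {rmorphism _ -> _}) by move=> a; rewrite /= psiC pC.
  apply: (kalg_hom_ext H phiC) => i.
  have [j ->|->] := unliftP ord_max i; last first.
    by rewrite [LHS]/= psiW rmorphM rmorphXn ptau expr1n mul1r pc.
  by rewrite -mwiden_var [LHS]/= psig e2X rmorphM rmorphXn pv expr1n mul1r pe1.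
have vX j : tau ^+ j * v ^+ j = 1 by rewrite -exprMn tv expr1n.
have psiI x : x \in slice_eqs [:: F] f t e -> psi x = 0.
  rewrite !inE => /or3P[/eqP->|/eqP->|/eqP->].
  - rewrite rmorphB rmorph1 rmorphM psiW psig (scal _ _ (hform_homog f)).
    have -> : tau ^+ d * c * (v ^+ d * e1 f) = tau ^+ d * v ^+ d * (e1 f * c) by ring.
    by rewrite vX fc mulr1 subrr.
  - rewrite rmorphB rmorph1 rmorphM rmorphXn psiW psig (scal _ _ td).
    have -> : (tau ^+ d * c) ^+ e * (v ^+ (1 + e * d) * e1 t) =
              tau ^+ (e * d) * v ^+ (e * d) * (e1 t * c ^+ e * v).
      by rewrite exprMn -exprM mulnC exprD expr1; ring.
    by rewrite vX tv mulr1 subrr.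
  - by rewrite psig (scal _ _ FD) e1F mulr0.
have [g gq] : exists g : {rmorphism chart_alg [:: F] f -> B}, forall x, g (q x) = psi x.
  by apply: factor_through_surj => // x /qker; apply: gen_ideal_vanish.
exists g; split=> [a|a]; first by rewrite -qC gq psiC.
by have [x <-] := qsurj a; rewrite gq ppsi.
Qed.

End FormalSmoothness.

(** * The Fermat curve *)

Section Fermat.

Lemma mderivXn (k : fieldType) (n : nat) (i l : 'I_n) (j : nat) :
  ('X_i ^+ j : {mpoly k[n]})^`M(l) = if l == i then 'X_i ^+ j.-1 *+ j else 0.
Proof.
rewrite mpolyXn mderivX mulmnE mnm1E [i == l]eq_sym.
have [->|_] := eqVneq; last by rewrite mul0n scale0r.
rewrite mul1n scaler_nat; case: j => [|j]; first by rewrite !mulr0n.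
by rewrite mpolyXn mulmSr addmK.
Qed.

Variables (k : fieldType) (m n a : nat).
Hypothesis char0 : [pchar k] =i pred0.
Hypotheses (m0 : (0 < m)%N) (n0 : (0 < n)%N) (a0 : (0 < a)%N).
Local Notation F := (fermat_poly k a m n).
Local Notation w := (weights1 m n).

Let X0h j : ('X_0 ^+ j : {mpoly k[3]}) \is (1 * j)%N.-homog for (wdeg w).
Proof. exact: dhomog_var. Qed.
Let X1h j : ('X_1 ^+ j : {mpoly k[3]}) \is (m * j)%N.-homog for (wdeg w).
Proof. exact: dhomog_var. Qed.
Let X2h j : ('X_2 ^+ j : {mpoly k[3]}) \is (n * j)%N.-homog for (wdeg w).
Proof. exact: dhomog_var. Qed.

Lemma fermat_homog : F \is (a * m * n)%N.-homog for (wdeg w).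
Proof.
have E1 : (m * (a * n) = a * m * n)%N by rewrite mulnCA mulnA.
have E2 : (n * (a * m) = a * m * n)%N by rewrite mulnC.
apply: rpredB; first apply: rpredD.
- by have := X0h (a * m * n); rewrite mul1n.
- by have := X1h (a * n); rewrite E1.
- by have := X2h (a * m); rewrite E2.
Qed.

Let natf_neq0 j : (0 < j)%N -> j%:R != 0 :> k.
Proof. by move=> j0; rewrite ((GRing.pcharf0P k).1 char0) -lt0n. Qed.

Lemma fermat_smooth_X0 (f : hform k w) :
  (f : {mpoly k[3]}) = 'X_0 -> hform_deg f = 1%N -> smooth_alg (chart_alg [:: F] f).
Proof.
move=> fE df; have N0 : (0 < a * m * n)%N by rewrite !muln_gt0 a0 m0.
have jac : 'X_0 ^+ (a * m * n).-1 = 0 * F +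
    \sum_(i < 3) (if i == 0 then ((a * m * n)%:R^-1)%:MP else 0) * F^`M(i).
  rewrite mul0r add0r (bigD1 0) //= big1 => [|i /negPf->]; last by rewrite mul0r.
  rewrite addr0 mderivB mderivD !mderivXn /= addr0 subr0 mul_mpolyC.
  by rewrite -scaler_nat scalerA mulVf ?scale1r // natf_neq0.
apply: (@chart_hypersurface_smooth _ _ _ f F 'X_0 1 _ _ _ 0 1 (a * m * n).-1
  fermat_homog) => //.
- by rewrite mul0n; have := X0h 1.
- by rewrite df; apply: dhomog1.
- by rewrite fE mulr1 expr1.
- by rewrite fE; exact: jac.
Qed.

(** With m b = n c + 1, the unit of degree 1 is
    x_1^b / x_2^c = x_1^(b+c) / (x_1 x_2)^c, and its inverse is
    x_2^(b+c) / (x_1 x_2)^b. *)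
Lemma fermat_smooth_X1X2 (f : hform k w) : coprime m n ->
  (f : {mpoly k[3]}) = 'X_1 * 'X_2 -> hform_deg f = (m + n)%N ->
  smooth_alg (chart_alg [:: F] f).
Proof.
move=> mn fE df.
have [b [c bc]] : exists b c, (m * b = n * c + 1)%N.
  case: (egcdnP n m0) => b c E _; exists b, c.
  by rewrite mulnC E [(n * _)%N]mulnC; congr (_ + _)%N; apply/eqP.
have b0 : (0 < b)%N by case: b bc => //; rewrite muln0 addn1.
have jac : ('X_1 * 'X_2) ^+ (a * n).-1 = 0 * F +
    \sum_(i < 3) (if i == 1 then ((a * n)%:R^-1) *: 'X_2 ^+ (a * n).-1 else 0)
                   * F^`M(i).
  rewrite mul0r add0r (bigD1 1) //= big1 => [|i /negPf->]; last by rewrite mul0r.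
  rewrite addr0 mderivB mderivD !mderivXn /= add0r subr0 -scaler_nat.
  rewrite -scalerAl -scalerAr scalerA mulVf ?scale1r ?natf_neq0 ?muln_gt0 ?a0 //.
  by rewrite exprMn mulrC.
apply: (@chart_hypersurface_smooth _ _ _ f F ('X_1 ^+ (b + c)) ('X_2 ^+ (b + c))
  _ _ _ c b _ fermat_homog b0).
- have := X1h (b + c); congr (_ \is _.-homog for _).
  by rewrite df; lia.
- have := X2h (b + c); congr (_ \is _.-homog for _).
  by rewrite df; lia.
- by rewrite fE -exprMn [(b + c)%N]addnC.
- by rewrite fE; exact: jac.
Qed.

(** When x_0 vanishes, the equation makes x_1 vanish as soon as x_2 does and
    conversely; all three would then vanish, and with them every form of
    positive degree. *)
Lemma fermat_point (x : proj_point w [:: F]) : x 'X_0 -> ~ x ('X_1 * 'X_2).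
Proof.
move=> x0.
have x1 : ~ x 1.
  by case: (pt_relevant x) => g xg x1; apply: xg; rewrite -[_ g]mulr1; apply: pt_idealM.
have xX g j : x (g ^+ j) -> x g.
  elim: j => [|j IH]; first by rewrite expr0 => /x1.
  by rewrite exprS => /pt_prime[|/IH].
have xN g : x g -> x (- g) by move=> xg; rewrite -mulN1r; apply: pt_idealM.
have Xx g j : (0 < j)%N -> x g -> x (g ^+ j).
  by case: j => // j _ xg; rewrite exprSr; apply: pt_idealM.
have xF : x F by apply: pt_contains; rewrite inE.
have N0 : (0 < a * m * n)%N by rewrite !muln_gt0 a0 m0.
have xd : x ('X_1 ^+ (a * n) - 'X_2 ^+ (a * m)).
  have := pt_idealD xF (xN _ (Xx _ _ N0 x0)).
  suff -> : F - 'X_0 ^+ (a * m * n) = 'X_1 ^+ (a * n) - 'X_2 ^+ (a * m) by [].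
  by rewrite /fermat_poly; ring.
have x12 : x 'X_1 <-> x 'X_2.
  split=> H; apply: xX.
    have := pt_idealD (Xx _ (a * n)%N _ H) (xN _ xd).
    by rewrite opprB addrC subrK muln_gt0 a0; apply.
  have := pt_idealD xd (Xx _ (a * m)%N _ H).
  by rewrite subrK muln_gt0 a0; apply.
move=> /pt_prime x12'.
have {x12'} [x1' x2'] : x 'X_1 /\ x 'X_2 by case: x12' => H; split=> //; apply/x12.
case: (pt_relevant x) => f; apply.
rewrite (mpolyE f) big_seq.
apply: (big_ind x) => [||M Mf]; first exact: pt_ideal0; first exact: pt_idealD.
rewrite -mul_mpolyC; apply: pt_idealM.
have Md : wdeg w M = hform_deg f := dhomog_mf (hform_homog f) Mf.
have [i Mi] : exists i, (0 < M i)%N.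
  apply/existsP; apply: contraTT (hform_deg_gt0 f) => /existsPn M0.
  by rewrite -leqNgt -Md /wdeg big1 // => i _; case: (M i) (M0 i) => //; rewrite muln0.
have xi : x 'X_i.
  have [->|->|->] : [\/ i = 0, i = 1 | i = 2%:R] by case: i {Mi} => [[|[|[]]] //= H];
    [apply: Or31|apply: Or32|apply: Or33]; apply: val_inj.
  - exact: x0.
  - exact: x1'.
  - exact: x2'.
rewrite mpolyXE_id (bigD1 i) //= mulrC; apply: pt_idealM; exact: Xx.
Qed.

End Fermat.

Theorem theorem4p3 (k : closedFieldType) (m n a : nat) :
  [pchar k]%R =i pred0 ->
  (0 < m)%N -> (m < n)%N -> coprime m n -> (0 < a)%N ->
  smooth_proj (weights1 m n) [:: fermat_poly k a m n].
Proof.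
move=> char0 m0 mn cop a0 x; have n0 : (0 < n)%N := leq_ltn_trans (leq0n m) mn.
have [x0|x0] := EM (x 'X_0).
  have d0 : (0 < m + n)%N by rewrite addn_gt0 m0.
  have hom : 'X_1 * 'X_2 \is [in k[3], (m + n).-homog for wdeg (weights1 m n)].
    have := dhomogM (@dhomog_var k _ (weights1 m n) 1 1) (@dhomog_var k _ (weights1 m n) 2%:R 1).
    by rewrite !expr1 !muln1.
  exists (HForm d0 hom); split; first exact: fermat_point.
  exact: fermat_smooth_X1X2.
have hom : 'X_0 \is [in k[3], 1.-homog for wdeg (weights1 m n)].
  by have := @dhomog_var k _ (weights1 m n) 0 1; rewrite expr1 muln1.
exists (HForm (isT : (0 < 1)%N) hom); split=> //.
exact: fermat_smooth_X0.
Qed.
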